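(* There is a universal constant $K\ge 0$ such that for every natural number $n$ that is a perfect square there exists a quantum channel $\mathcal N:S_1^{2n}\to S_1^{2n}$ with $$C_{prod}^{n}(\mathcal N\otimes\mathcal N)\ \ge\ \frac13\ln n+2\,C_{prod}^{\sqrt n}(\mathcal N)-K.$$
   Context: $S_1^m$ is $M_m$ (complex $m\times m$ matrices) with the trace norm. A quantum channel $S_1^k\to S_1^m$ is a completely positive trace preserving linear map. A state is a positive semidefinite element of trace one; a pure state is a rank-one state. $S(\rho)=-\mathrm{tr}(\rho\ln\rho)$ is the von Neumann entropy (natural logarithm). $tr_d$ and $id_d$ denote the trace and the identity map on $M_d$. The channel $\mathcal N\otimes\mathcal N$ acts on $S_1^{2n}\otimes S_1^{2n}=S_1^{4n^2}$. For a quantum channel $\mathcal M:S_1^m\to S_1^m$ and $1\le d\le m$, $$C_{prod}^d(\mathcal M):=\sup\Big\{S\Big(\sum_{i=1}^N\lambda_i(\mathcal M\circ\phi_i)\big((tr_d\otimes id_d)(\eta_i)\big)\Big)+\sum_{i=1}^N\lambda_i\Big[S\big((id_d\otimes tr_d)(\eta_i)\big)-S\big((id_d\otimes(\mathcal M\circ\phi_i))(\eta_i)\big)\Big]\Big\},$$ the supremum running over all $N\in\mathbb N$, all probability distributions $(\lambda_i)_{i=1}^N$, all quantum channels $\phi_i:S_1^d\to S_1^m$ and all pure states $\eta_i\in S_1^d\otimes S_1^d$. *)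

(* Defs.v *)
From HB Require Import structures.
From mathcomp Require Import all_boot all_order all_algebra.
From mathcomp Require Import complex mxtens.
From mathcomp Require Import all_classical all_reals all_analysis.

Set Implicit Arguments.
Unset Strict Implicit.
Unset Printing Implicit Defensive.

Import Order.TTheory GRing.Theory Num.Theory.

Local Open Scope classical_set_scope.
Local Open Scope ring_scope.
Local Open Scope complex_scope.
Local Open Scope sesquilinear_scope.

(* S_1^a (x) S_1^b is 'M_(a * b), with the Kronecker product *t of mxtens:
   the basis vector e_i (x) e_k of C^a (x) C^b has index mxtens_index (i, k). *)

Section Quantum.
Variable R : realType.
Local Notation C := R[i].

Definition psd m (A : 'M[C]_m) : Prop :=
  forall v : 'rV[C]_m, 0 <= (v *m A *m v ^t*) 0 0.

Definition is_state m (A : 'M[C]_m) : Prop := psd A /\ \tr A = 1.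

Definition is_pure_state m (A : 'M[C]_m) : Prop :=
  is_state A /\ \rank A = 1%N.

(* The functional calculus A |-> ln A on Hermitian matrices. The value ln 0 = 0
   of the library yields the usual convention 0 * ln 0 = 0 in [entropy]. *)
Definition logmx m (A : 'M[C]_m) : 'M[C]_m :=
  invmx (spectralmx A)
    *m diag_mx (map_mx (fun z : C => (ln (complex.Re z))%:C) (spectral_diag A))
    *m spectralmx A.

Definition entropy m (A : 'M[C]_m) : R := - complex.Re (\tr (A *m logmx A)).

(* f (x) g, extended from the matrix units; meaningful for linear f and g. *)
Definition tensmap k1 m1 k2 m2 (f : 'M[C]_k1 -> 'M[C]_m1)
    (g : 'M[C]_k2 -> 'M[C]_m2) (X : 'M[C]_(k1 * k2)) : 'M[C]_(m1 * m2) :=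
  \sum_(i < k1) \sum_(j < k1) \sum_(k < k2) \sum_(l < k2)
    X (mxtens_index (i, k)) (mxtens_index (j, l))
      *: (f (delta_mx i j) *t g (delta_mx k l)).

(* tr (x) id *)
Definition ptrace1 a b (X : 'M[C]_(a * b)) : 'M[C]_b :=
  \matrix_(k, l) \sum_(i < a) X (mxtens_index (i, k)) (mxtens_index (i, l)).

(* id (x) tr *)
Definition ptrace2 a b (X : 'M[C]_(a * b)) : 'M[C]_a :=
  \matrix_(i, j) \sum_(k < b) X (mxtens_index (i, k)) (mxtens_index (j, k)).

Definition completely_positive k m (f : 'M[C]_k -> 'M[C]_m) : Prop :=
  forall (j : nat) (X : 'M[C]_(j * k)), psd X -> psd (tensmap id f X).

Definition is_channel k m (f : 'M[C]_k -> 'M[C]_m) : Prop :=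
  [/\ linear f, completely_positive f & forall A, \tr (f A) = \tr A].

Definition Cprod_value m d (M : 'M[C]_m -> 'M[C]_m) N (lam : 'I_N -> R)
    (phi : 'I_N -> 'M[C]_d -> 'M[C]_m) (eta : 'I_N -> 'M[C]_(d * d)) : R :=
  entropy (\sum_(i < N) (lam i)%:C *: M (phi i (ptrace1 (eta i))))
  + \sum_(i < N) lam i * (entropy (ptrace2 (eta i))
                          - entropy (tensmap id (M \o phi i) (eta i))).

(* The supremum is taken in \bar R because the real-valued sup of the library
   is 0 on unbounded sets. *)
Definition Cprod m (d : nat) (M : 'M[C]_m -> 'M[C]_m) : \bar R :=
  ereal_sup [set x | exists (N : nat) (lam : 'I_N -> R)
      (phi : 'I_N -> 'M[C]_d -> 'M[C]_m) (eta : 'I_N -> 'M[C]_(d * d)),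
    [/\ (forall i, 0 <= lam i) /\ \sum_(i < N) lam i = 1,
        forall i, is_channel (phi i),
        forall i, is_pure_state (eta i)
      & x = (Cprod_value M lam phi eta)%:E]].

Lemma ptrace1_tens a b (A : 'M[C]_a) (B : 'M[C]_b) :
  ptrace1 (A *t B) = \tr A *: B.
Proof.
apply/matrixP => k l; rewrite !mxE mulr_suml.
by apply: eq_bigr => i _; rewrite tensmxE.
Qed.

Lemma ptrace2_tens a b (A : 'M[C]_a) (B : 'M[C]_b) :
  ptrace2 (A *t B) = \tr B *: A.
Proof.
apply/matrixP => k l; rewrite !mxE mulr_suml.
by apply: eq_bigr => i _; rewrite tensmxE mulrC.
Qed.

Lemma linear_deltaE k m (f : 'M[C]_k -> 'M[C]_m) : linear f ->
  forall A, f A = \sum_i \sum_j A i j *: f (delta_mx i j).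
Proof.
move=> lf A; pose F := GRing.isLinear.Build _ _ _ _ f lf.
pose g : {linear 'M[C]_k -> 'M[C]_m} := HB.pack f F.
rewrite -[f]/(g : _ -> _) {1}(matrix_sum_delta A) linear_sum.
apply: eq_bigr => i _; rewrite linear_sum.
by apply: eq_bigr => j _; rewrite linearZ.
Qed.

Lemma tensmap_tens k1 m1 k2 m2 (f : 'M[C]_k1 -> 'M[C]_m1)
    (g : 'M[C]_k2 -> 'M[C]_m2) : linear f -> linear g ->
  forall A B, tensmap f g (A *t B) = f A *t g B.
Proof.
move=> lf lg A B; rewrite (linear_deltaE lf A) (linear_deltaE lg B).
apply/matrixP => p q; rewrite /tensmap !mxE !summxE mulr_suml.
apply: eq_bigr => i _; rewrite !summxE mulr_suml.
apply: eq_bigr => j _; rewrite !summxE mulr_sumr.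
apply: eq_bigr => k _; rewrite !summxE mulr_sumr.
by apply: eq_bigr => l _; rewrite !mxE !mxtens_indexK/= mulrACA.
Qed.

End Quantum.

(* Main.v *)
Require Import Defs.
From mathcomp Require Import all_boot all_order all_algebra.
From mathcomp Require Import complex mxtens.
From mathcomp Require Import all_classical all_reals all_analysis.
From mathcomp Require Import ring lra.

(* The channel measures an input flag and then either depolarizes the remaining
   n-dimensional system with probability 1/3, or dephases it completely. With
   d-dimensional entanglement the first branch has rate (2/3) (ln n + ln d), the
   second one ln n, up to constants. For d = sqrt n both equal ln n, so one copy
   is worth ln n. With d = n, two copies can spend all the entanglement on the
   first branch of one copy, for (4/3) ln n, and use the second branch of the
   other one for ln n.

   The bound for one copy amounts to S(A) <= S(AB) + const for the joint output:
   extended to unnormalized positive operators, the entropy is subadditive,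
   superadditive up to ln 2 times the trace, and exactly additive on sums
   sum_i Y_i (x) |i><i|. All of this follows by comparing the entropy with
   sum_a f(t_a), f(x) = - x ln x, for a decomposition sum_a t_a |v_a><v_a|. *)

Set Implicit Arguments.
Unset Strict Implicit.
Unset Printing Implicit Defensive.

Import Order.TTheory GRing.Theory Num.Theory.
Local Open Scope complex_scope.
Local Open Scope sesquilinear_scope.
Local Open Scope ring_scope.

(** * The function - x ln x *)

Section Scalar.
Variable R : realType.

Definition entf (x : R) : R := - (x * ln x).

Lemma ln_le_subr1 (x : R) : 0 < x -> ln x <= x - 1.
Proof.
move=> x0; have := expR_ge1Dx (ln x); rewrite lnK ?posrE//; lra.
Qed.

(* [t] is the image of [s] under the doubly substochastic matrix [q], as in the
   Schur-Horn theorem. *)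
Lemma entf_sum_le (I J : finType) (p q : I -> J -> R) (t : I -> R) (s : J -> R) :
  (forall a j, 0 <= p a j) -> (forall a j, 0 <= q a j) ->
  (forall a j, p a j = q a j * s j) -> (forall a, \sum_j q a j <= 1) ->
  (forall a, t a = \sum_j p a j) -> (forall j, s j = \sum_a p a j) ->
  \sum_j entf (s j) <= \sum_a entf (t a).
Proof.
move=> p0 q0 pq q1 tE sE.
have t0 a : 0 <= t a by rewrite tE sumr_ge0.
have -> : \sum_a entf (t a) = \sum_a \sum_j - (p a j * ln (t a)).
  by apply: eq_bigr => a _; rewrite sumrN -mulr_suml -tE.
have -> : \sum_j entf (s j) = \sum_a \sum_j - (p a j * ln (s j)).
  rewrite exchange_big; apply: eq_bigr => j _.
  by rewrite sumrN -mulr_suml -sE.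
(* ln x <= x - 1 at x = t a / s j *)
have le a j : p a j - q a j * t a <= p a j * ln (s j) - p a j * ln (t a).
  have := p0 a j; rewrite le_eqVlt => /predU1P[<-|p_gt0].
    by rewrite !mul0r subrr sub0r oppr_le0 mulr_ge0.
  have tgt : 0 < t a.
    by apply: lt_le_trans p_gt0 _; rewrite tE (bigD1 j)//= lerDl sumr_ge0.
  have sgt : 0 < s j.
    by apply: lt_le_trans p_gt0 _; rewrite sE (bigD1 a)//= lerDl sumr_ge0.
  have := ln_le_subr1 (divr_gt0 tgt sgt); rewrite lnM ?posrE ?invr_gt0// lnV ?posrE//.
  rewrite -(ler_pM2l p_gt0) => h; rewrite -mulrBr -lerN2.
  have -> : - (p a j - q a j * t a) = p a j * (t a / s j - 1).
    by rewrite pq; field; rewrite gt_eqF.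
  by rewrite -mulrN opprB.
rewrite -subr_ge0 -sumrB.
under eq_bigr do rewrite -sumrB.
(* The inner sum is [t a * (1 - \sum_j q a j)], where the row sums of [q] are at most 1. *)
apply: le_trans (_ : 0 <= \sum_a \sum_j (p a j - q a j * t a)) _.
  apply: sumr_ge0 => a _; rewrite sumrB -tE -mulr_suml subr_ge0.
  by rewrite ler_piMl.
by apply: ler_sum => a _; apply: ler_sum => j _; rewrite opprK [leRHS]addrC.
Qed.

(** The bound [ln x <= x - 1] at [x = (a + b) / (2 * a)] leaves the error [(b - a) / 2], which
    cancels against the one with [a] and [b] exchanged. *)
Lemma entfD_ge (x y : R) : 0 <= x -> 0 <= y ->
  entf x + entf y - (x + y) * ln 2 <= entf (x + y).
Proof.
have key (a b : R) : 0 <= a -> 0 <= b -> a * ln (a + b) <= a * ln a + a * ln 2 + (b - a) / 2.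
  rewrite le_eqVlt => /predU1P[<-|a0 b0]; first by rewrite !mul0r; lra.
  have ab : 0 < a + b by lra.
  have a2 : 0 < 2 * a by lra.
  have := ln_le_subr1 (divr_gt0 ab a2).
  rewrite lnM ?posrE ?invr_gt0// lnV ?posrE// lnM ?posrE//.
  rewrite -(ler_pM2l a0).
  have -> : a * ((a + b) / (2 * a) - 1) = (b - a) / 2 by field; rewrite gt_eqF.
  by lra.
move=> x0 y0; have := key x y x0 y0; have := key y x y0 x0; rewrite (addrC y x) /entf; lra.
Qed.

(** The right-hand side is the tangent at [m^-1] to the concave function [entf]. *)
Lemma entf_le (m x : R) : 0 < m -> 0 <= x -> entf x <= x * ln m - x + m^-1.
Proof.
move=> m0; rewrite le_eqVlt => /predU1P[<-|x0].
  by rewrite /entf !mul0r !(oppr0, add0r) invr_ge0 ltW.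
have xm : 0 < m * x by rewrite mulr_gt0.
have : ln (m * x)^-1 <= (m * x)^-1 - 1 by apply: ln_le_subr1; rewrite invr_gt0.
rewrite lnV ?posrE// lnM ?posrE// -(ler_pM2l x0).
have -> : x * ((m * x)^-1 - 1) = m^-1 - x by field; rewrite !gt_eqF.
rewrite /entf; lra.
Qed.

Lemma entfM (c x : R) : 0 <= c -> 0 <= x -> entf (c * x) = c * entf x + x * entf c.
Proof.
rewrite /entf le_eqVlt => /predU1P[<-|c0]; first by rewrite !mul0r oppr0 mulr0 addr0.
rewrite le_eqVlt => /predU1P[<-|x0]; first by rewrite !(mulr0,mul0r) oppr0 mulr0 addr0.
by rewrite lnM ?posrE//; ring.
Qed.

Lemma entf_ge0 (x : R) : 0 <= x <= 1 -> 0 <= entf x.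
Proof. by move=> /andP[x0 x1]; rewrite /entf oppr_ge0 mulr_ge0_le0// ln_le0. Qed.

End Scalar.

(** * Inner products of row vectors *)

Section Vectors.
Variable R : realType.
Local Notation C := R[i].

(* Vectors are rows, so [proj v] is the rank-one operator |v><v|. *)
Definition ip m (u v : 'rV[C]_m) : C := (u *m v ^t*) 0 0.
Definition proj m (v : 'rV[C]_m) : 'M[C]_m := v ^t* *m v.
Definition expect m (u : 'rV[C]_m) (A : 'M[C]_m) : R := complex.Re ((u *m A *m u ^t*) 0 0).
Definition ip2 m (u v : 'rV[C]_m) : R := complex.Re (`|ip u v| ^+ 2).
Definition orthonormal m (I : finType) (v : I -> 'rV[C]_m) : Prop :=
  forall a b, ip (v a) (v b) = (a == b)%:R.

Lemma Re_real_mul (x : R) (z : C) : complex.Re (x%:C * z) = x * complex.Re z.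
Proof. by case: z => a b /=; rewrite mul0r subr0. Qed.

Lemma ge0_ReK (z : C) : 0 <= z -> (complex.Re z)%:C = z.
Proof. by case: z => a b; rewrite lecE /= => /andP[/eqP ->]. Qed.

Lemma Re_ge0 (z : C) : 0 <= z -> 0 <= complex.Re z.
Proof. by case: z => a b; rewrite lecE /= => /andP[]. Qed.

Lemma Re_sum (I : Type) (r : seq I) (P : pred I) (F : I -> C) :
  complex.Re (\sum_(i <- r | P i) F i) = \sum_(i <- r | P i) complex.Re (F i).
Proof. by apply: (big_morph (fun z : C => complex.Re z)) => // -[a b] [c d]. Qed.

Lemma ip2E m (u v : 'rV[C]_m) : (ip2 u v)%:C = `|ip u v| ^+ 2.
Proof. by rewrite ge0_ReK ?exprn_ge0. Qed.

Lemma ip2_ge0 m (u v : 'rV[C]_m) : 0 <= ip2 u v.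
Proof. by rewrite Re_ge0 ?exprn_ge0. Qed.

Lemma ipE m (u v : 'rV[C]_m) : ip u v = \sum_j u 0 j * (v 0 j)^*.
Proof. by rewrite /ip mxE; apply: eq_bigr => j _; rewrite !mxE. Qed.

Lemma ipC m (u v : 'rV[C]_m) : ip v u = (ip u v)^*.
Proof.
rewrite !ipE rmorph_sum; apply: eq_bigr => j _.
by rewrite rmorphM/= conjCK mulrC.
Qed.

Lemma ip2C m (u v : 'rV[C]_m) : ip2 v u = ip2 u v.
Proof. by rewrite /ip2 ipC norm_conjC. Qed.

Lemma ip_ge0 m (u : 'rV[C]_m) : 0 <= ip u u.
Proof. by rewrite ipE sumr_ge0 // => j _; rewrite mul_conjC_ge0. Qed.

Lemma ipDl m (u u' v : 'rV[C]_m) : ip (u + u') v = ip u v + ip u' v.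
Proof. by rewrite /ip mulmxDl mxE. Qed.

Lemma ipBl m (u u' v : 'rV[C]_m) : ip (u - u') v = ip u v - ip u' v.
Proof. by rewrite /ip mulmxBl !mxE. Qed.

Lemma ipDr m (u u' v : 'rV[C]_m) : ip v (u + u') = ip v u + ip v u'.
Proof. by rewrite ipC ipDl rmorphD/= -!ipC. Qed.

Lemma ipBr m (u u' v : 'rV[C]_m) : ip v (u - u') = ip v u - ip v u'.
Proof. by rewrite ipC ipBl rmorphB/= -!ipC. Qed.

Lemma ipZl m c (u v : 'rV[C]_m) : ip (c *: u) v = c * ip u v.
Proof. by rewrite /ip -scalemxAl mxE. Qed.

Lemma ip_suml m (I : finType) (u : I -> 'rV[C]_m) v :
  ip (\sum_a u a) v = \sum_a ip (u a) v.
Proof. by rewrite /ip mulmx_suml summxE. Qed.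

Lemma ip_sumr m (I : finType) (u : I -> 'rV[C]_m) v :
  ip v (\sum_a u a) = \sum_a ip v (u a).
Proof. by rewrite ipC ip_suml rmorph_sum/=; apply: eq_bigr => a _; rewrite -ipC. Qed.

Lemma ipZr m c (u v : 'rV[C]_m) : ip u (c *: v) = c^* * ip u v.
Proof. by rewrite ipC ipZl rmorphM/= -ipC. Qed.

Lemma sandwich_proj m (u v : 'rV[C]_m) :
  (u *m proj v *m u ^t*) 0 0 = `|ip u v| ^+ 2.
Proof.
rewrite /proj mulmxA -mulmxA mxE big_ord1 normCK -ipC; congr (_ * _).
Qed.

Lemma expect_sum_proj m (I : finType) (t : I -> R) (v : I -> 'rV[C]_m) A u :
  A = \sum_a (t a)%:C *: proj (v a) -> expect u A = \sum_a t a * ip2 u (v a).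
Proof.
move=> ->; rewrite /expect mulmx_sumr mulmx_suml summxE Re_sum.
apply: eq_bigr => a _; rewrite -scalemxAr -scalemxAl mxE sandwich_proj -ip2E.
by rewrite Re_real_mul.
Qed.

Lemma expect_ge0 m (A : 'M[C]_m) u : psd A -> 0 <= expect u A.
Proof. by move=> h; apply: Re_ge0; apply: h. Qed.

Lemma parseval m (U : 'M[C]_m) (v : 'rV[C]_m) : U \is unitarymx ->
  ip v v = \sum_j (ip2 v (row j U))%:C.
Proof.
move=> Uu; rewrite -{1}(mulmxKtV v Uu)// .
have -> : ip (v *m U ^t* *m U) v = ip (v *m U^t*) (v *m U^t*).
  by rewrite /ip -!mulmxA trmx_mul map_mxM /= trmxCK.
rewrite ipE; apply: eq_bigr => j _; rewrite ip2E normCK.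
suff -> : (v *m U ^t*) 0 j = ip v (row j U) by [].
by rewrite ipE !mxE; apply: eq_bigr => k _; rewrite !mxE.
Qed.

Lemma orthonormal_rows m (U : 'M[C]_m) : U \is unitarymx ->
  orthonormal (fun j => row j U).
Proof.
move=> /unitarymxP/matrixP h a b.
have -> : (a == b)%:R = (1%:M : 'M[C]_m) a b by rewrite mxE.
by rewrite -h ipE mxE; apply: eq_bigr => k _; rewrite !mxE.
Qed.

Lemma parseval_unit m (U : 'M[C]_m) (v : 'rV[C]_m) : U \is unitarymx -> ip v v = 1 ->
  \sum_j ip2 v (row j U) = 1.
Proof. by move=> Uu v1; apply: complexI; rewrite rmorph_sum/= -parseval. Qed.

Lemma bessel m (I : finType) (v : I -> 'rV[C]_m) (u : 'rV[C]_m) :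
  orthonormal v -> ip u u = 1 -> \sum_a ip2 u (v a) <= 1.
Proof.
(* [y] is the orthogonal projection of [u] onto the span of the [v a]; the claim is that [u - y] has
   nonnegative squared norm. *)
move=> ov u1; pose y := \sum_a ip u (v a) *: v a.
have yu : ip y u = \sum_a (ip2 u (v a))%:C.
  rewrite ip_suml; apply: eq_bigr => a _; rewrite ipZl ip2E normCK -ipC//.
have yy : ip y y = ip y u.
  rewrite yu {1}/y ip_suml; apply: eq_bigr => a _; rewrite ipZl ip2E normCK.
  congr (_ * _); rewrite /y ip_sumr (bigD1 a)//= big1 => [|b ba].
    by rewrite ipZr ov eqxx mulr1 addr0.
  by rewrite ipZr ov eq_sym (negbTE ba) mulr0.
have yu0 : 0 <= ip y u by rewrite yu sumr_ge0 // => a _; rewrite ler0c ip2_ge0.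
have := ip_ge0 (u - y); rewrite ipBl !ipBr yy [ip u y]ipC geC0_conj// subrr subr0 u1.
by rewrite yu -rmorph_sum subr_ge0 -[1](rmorph1 (real_complex R)) lecR.
Qed.

End Vectors.

(** * Entropy through rank-one decompositions *)

Section Spectral.
Variable R : realType.
Local Notation C := R[i].

(** Polarization: [psd] makes the quadratic form of [A] real, so that of [B = A - A ^t*] vanishes.
    Testing it on [e_i + c e_j] relates [B i j] to [B j i]. *)
Lemma psd_hermitian m (A : 'M[C]_m) : psd A -> A ^t* = A.
Proof.
move=> pA; pose B := A - A ^t*.
have B0 (u : 'rV[C]_m) : ip (u *m B) u = 0.
  have AC : (u *m A ^t* *m u ^t*) 0 0 = ((u *m A *m u ^t*) 0 0)^*.
    transitivity (((u *m A *m u ^t*) ^t*) 0 0).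
      by rewrite !trmx_mul !map_mxM/= trmxCK mulmxA.
    by rewrite [LHS]mxE; congr (_^*); rewrite [LHS]mxE.
  have -> : ip (u *m B) u = (u *m A *m u ^t*) 0 0 - (u *m A ^t* *m u ^t*) 0 0.
    by rewrite /ip mulmxBr mulmxBl [LHS]mxE; congr (_ + _); rewrite [LHS]mxE.
  by rewrite AC geC0_conj ?subrr //; exact: pA.
have Bc i j (c : C) : c^* * B i j + c * B j i = 0.
  have E k l : ip (delta_mx 0 k *m B) (delta_mx 0 l) = B k l.
    rewrite ipE (bigD1 l)//= big1 => [|l' ll].
      by rewrite !mxE !eqxx conjC1 mulr1 addr0 (bigD1 k)//= big1 ?mxE ?eqxx ?mul1r ?addr0
        // => k' kk; rewrite !mxE (negbTE kk) andbF mul0r.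
    by rewrite !mxE (negbTE ll) andbF conjC0 mulr0.
  have := B0 (delta_mx 0 i + c *: delta_mx 0 j).
  rewrite mulmxDl -scalemxAl ipDl ipZl !ipDr !ipZr !E.
  have Bkk k : B k k = 0 by rewrite -E B0.
  by rewrite !Bkk !(mulr0, add0r, addr0).
apply/esym/eqP; rewrite -subr_eq0; apply/eqP/matrixP => i j; rewrite -/B [RHS]mxE.
(* The choice [c = 1] gives [B i j = - B j i], and [c = 'i] gives [B i j = B j i]. *)
have h1 := Bc i j 1; have hi := Bc i j 'i.
rewrite conjC1 !mul1r in h1; rewrite conjCi mulNr addrC -mulrBr in hi.
move/eqP: hi; rewrite mulf_eq0 (negbTE (neq0Ci _)) /= subr_eq0 => /eqP hi.
by move/eqP: h1; rewrite hi -mulr2n mulrn_eq0 /= => /eqP.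
Qed.

Definition ev m (A : 'M[C]_m) (j : 'I_m) : R := complex.Re (spectral_diag A 0 j).
Definition evec m (A : 'M[C]_m) (j : 'I_m) : 'rV[C]_m := row j (spectralmx A).

Lemma evec_orthonormal m (A : 'M[C]_m) : orthonormal (evec A).
Proof. exact/orthonormal_rows/spectral_unitarymx. Qed.

Lemma entropyE m (A : 'M[C]_m) : psd A -> entropy A = \sum_j entf (ev A j).
Proof.
move=> pA; have nA : A \is normalmx by apply/normalmxP; rewrite psd_hermitian.
rewrite /entropy /logmx.
set L := map_mx _ _; have /orthomx_spectralP AE := nA.
rewrite {1}AE !mulmxA mulmxK ?spectral_unit// mxtrace_mulC !mulmxA.
rewrite mulmxV ?spectral_unit// mul1mx mulmx_diag mxtrace_diag Re_sum -sumrN.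
by apply: eq_bigr => j _; rewrite !mxE mulrC Re_real_mul mulrC.
Qed.

Lemma mulmx_diag_rows m (U : 'M[C]_m) (d : 'rV[C]_m) :
  U ^t* *m diag_mx d *m U = \sum_j d 0 j *: proj (row j U).
Proof.
apply/matrixP => k l; rewrite summxE -mulmxA mxE; apply: eq_bigr => j _.
by rewrite mul_diag_mx !mxE big_ord1 !mxE mulrCA.
Qed.

Lemma spectral_expand m (A : 'M[C]_m) : psd A ->
  A = \sum_j spectral_diag A 0 j *: proj (evec A j).
Proof.
move=> pA; have nA : A \is normalmx by apply/normalmxP; rewrite psd_hermitian.
have /orthomx_spectralP {1}-> := nA.
by rewrite invmx_unitary ?spectral_unitarymx // mulmx_diag_rows.
Qed.

Lemma spectral_diag_sandwich m (A : 'M[C]_m) j : psd A ->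
  spectral_diag A 0 j = (evec A j *m A *m (evec A j) ^t*) 0 0.
Proof.
move=> pA; rewrite [X in _ *m X *m _](spectral_expand pA) mulmx_sumr mulmx_suml summxE.
rewrite (bigD1 j)//= big1 => [|k kj].
  by rewrite -scalemxAr -scalemxAl mxE sandwich_proj evec_orthonormal eqxx
    normr1 expr1n mulr1 addr0.
rewrite -scalemxAr -scalemxAl mxE sandwich_proj evec_orthonormal.
by rewrite eq_sym (negbTE kj) normr0 expr0n mulr0.
Qed.

Lemma ev_expect m (A : 'M[C]_m) j : psd A -> ev A j = expect (evec A j) A.
Proof. by move=> pA; rewrite /ev spectral_diag_sandwich. Qed.

Lemma ev_ge0 m (A : 'M[C]_m) j : psd A -> 0 <= ev A j.
Proof. by move=> pA; rewrite ev_expect ?expect_ge0. Qed.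

Lemma psdE m (A : 'M[C]_m) : psd A -> A = \sum_j (ev A j)%:C *: proj (evec A j).
Proof.
move=> pA; rewrite {1}(spectral_expand pA); apply: eq_bigr => j _.
by rewrite ge0_ReK // spectral_diag_sandwich.
Qed.

Lemma ip_evec m (A : 'M[C]_m) j : ip (evec A j) (evec A j) = 1.
Proof. by rewrite evec_orthonormal eqxx. Qed.

Lemma parseval_evec m (A : 'M[C]_m) v : ip v v = 1 -> \sum_j ip2 v (evec A j) = 1.
Proof. exact/parseval_unit/spectral_unitarymx. Qed.

(** Measuring [A] in the eigenbasis of an arbitrary [B] cannot lower the entropy: the squared
    overlaps have row sums at most 1 by Bessel and column sums 1 by Parseval. *)
Lemma peierls m (I : finType) (t : I -> R) (v : I -> 'rV[C]_m) A B :
  (forall a, 0 <= t a) -> orthonormal v -> A = \sum_a (t a)%:C *: proj (v a) ->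
  \sum_a entf (t a) <= \sum_j entf (expect (evec B j) A).
Proof.
move=> t0 ov AE.
apply: (@entf_sum_le _ _ _ (fun j a => t a * ip2 (evec B j) (v a))
         (fun j a => ip2 (evec B j) (v a))) => [j a|j a|j a|j|j|a].
- by rewrite mulr_ge0 ?ip2_ge0.
- exact: ip2_ge0.
- by rewrite mulrC.
- by apply: bessel => //; exact: ip_evec.
- exact: expect_sum_proj.
- rewrite -mulr_sumr; under eq_bigr do rewrite ip2C.
  by rewrite parseval_evec ?mulr1 // ov eqxx.
Qed.

Lemma entropy_le_expect m (A B : 'M[C]_m) : psd A ->
  entropy A <= \sum_j entf (expect (evec B j) A).
Proof.
move=> pA; rewrite entropyE //; apply: (peierls _ _ (evec_orthonormal A) (psdE pA)) => j.
exact: ev_ge0.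
Qed.

(** The unit vectors [v a] may overlap. In the eigenbasis [u] of [A] the substochastic matrix is
    [t a * ip2 (v a) (u j) / s j]; its row sums are at most 1 because [A] dominates each term
    [t a |v_a><v_a|]. *)
Lemma entropy_le_ensemble m (I : finType) (t : I -> R) (v : I -> 'rV[C]_m) A :
  psd A -> (forall a, 0 <= t a) -> (forall a, ip (v a) (v a) = 1) ->
  A = \sum_a (t a)%:C *: proj (v a) -> entropy A <= \sum_a entf (t a).
Proof.
move=> pA t0 v1 AE; rewrite entropyE //.
pose s := ev A; pose u := evec A.
have sE j : s j = \sum_a t a * ip2 (v a) (u j).
  by rewrite /s ev_expect// (expect_sum_proj _ AE); apply: eq_bigr => a _; rewrite ip2C.
have s0 j : 0 <= s j by exact: ev_ge0.
apply: (@entf_sum_le _ _ _ (fun a j => t a * ip2 (v a) (u j))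
         (fun a j => t a * (ip2 (v a) (u j) / s j))) => [a j|a j|a j|a|a|j].
- by rewrite mulr_ge0 ?ip2_ge0.
- by rewrite mulr_ge0 ?divr_ge0 ?ip2_ge0 ?s0.
(* For [s j = 0] the quotient is 0, and so is [t a * ip2 (v a) (u j)], being a term of a nonnegative
   sum equal to [s j]. *)
- have [sj0|sj0] := eqVneq (s j) 0; last by rewrite mulrA divfK.
  rewrite [ev A j]sj0 mulr0; apply/eqP; rewrite eq_le mulr_ge0 ?ip2_ge0// andbT.
  by rewrite -[leRHS]sj0 sE (bigD1 a)//= lerDl sumr_ge0 // => b _; rewrite mulr_ge0 ?ip2_ge0.
- rewrite -mulr_sumr; set q := \sum_j _.
  have q0 : 0 <= q by rewrite sumr_ge0// => j _; rewrite divr_ge0 ?ip2_ge0 ?s0.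
  (* y = A^(-1) v_a, where / 0 = 0 makes A^(-1) the pseudo-inverse; then
     <y|A|y> = q and A >= t_a |v_a><v_a| give t_a q^2 <= q. *)
  pose y := \sum_j (ip (v a) (u j) / (s j)%:C) *: u j.
  have yu k : ip y (u k) = ip (v a) (u k) / (s k)%:C.
    rewrite ip_suml (bigD1 k)//= big1 => [|j jk].
      by rewrite ipZl ip_evec mulr1 addr0.
    by rewrite ipZl evec_orthonormal (negbTE jk) mulr0.
  have yv : ip y (v a) = q%:C.
    rewrite ip_suml rmorph_sum /=; apply: eq_bigr => j _.
    by rewrite ipZl rmorphM fmorphV /= ip2E normCK -(ipC (v a)) mulrAC.
  have y2 : expect y A = q.
    rewrite (expect_sum_proj _ (psdE pA)); apply: eq_bigr => j _.
    apply: complexI; rewrite rmorphM/= ip2E yu normrM exprMn normfV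
      [`|_%:C|]ger0_norm ?ler0c//.
    rewrite rmorphM fmorphV /= ip2E -/(s j).
    have [->|sj0] := eqVneq (s j) 0; first by rewrite rmorph0 mul0r invr0 mulr0.
    by field; rewrite fmorph_eq0.
  have : t a * q ^+ 2 <= q.
    rewrite -[leRHS]y2 (expect_sum_proj _ AE) (bigD1 a)//=.
    have -> : ip2 y (v a) = q ^+ 2.
      by apply: complexI; rewrite ip2E yv ger0_norm ?ler0c// rmorphXn.
    by rewrite lerDl sumr_ge0// => b _; rewrite mulr_ge0 ?ip2_ge0.
  have := q0; rewrite le_eqVlt => /predU1P[<-|q_gt0]; first by rewrite mulr0.
  by rewrite expr2 mulrA -[leRHS]mul1r ler_pM2r.
- by rewrite -mulr_sumr parseval_evec ?mulr1.
- exact: sE.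
Qed.

Lemma psd_sum_proj m (I : finType) (t : I -> R) (v : I -> 'rV[C]_m) :
  (forall a, 0 <= t a) -> psd (\sum_a (t a)%:C *: proj (v a)).
Proof.
move=> t0 u; rewrite mulmx_sumr mulmx_suml summxE sumr_ge0 // => a _.
by rewrite -scalemxAr -scalemxAl mxE sandwich_proj mulr_ge0 ?exprn_ge0//; rewrite ?ler0c.
Qed.

(** The ensemble bound and the Peierls bound in the eigenbasis of [A] meet. An incomplete family [v]
    is allowed, so entropies can be read off any orthonormal decomposition, whatever basis
    [spectralmx] selects. *)
Lemma entropy_orthonormal m (I : finType) (t : I -> R) (v : I -> 'rV[C]_m) A :
  (forall a, 0 <= t a) -> orthonormal v -> A = \sum_a (t a)%:C *: proj (v a) ->
  entropy A = \sum_a entf (t a).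
Proof.
move=> t0 ov AE; have pA : psd A by rewrite AE; exact: psd_sum_proj.
apply/eqP; rewrite eq_le; apply/andP; split.
  by apply: entropy_le_ensemble AE => // a; rewrite ov eqxx.
rewrite entropyE //; apply: le_trans (peierls A t0 ov AE) _.
by under eq_bigr do rewrite -ev_expect//.
Qed.

End Spectral.

(** * Entropy inequalities *)

Section Entropy.
Variable R : realType.
Local Notation C := R[i].

Lemma big_pair (V : nmodType) (I J : finType) (F : I * J -> V) :
  \sum_p F p = \sum_i \sum_j F (i, j).
Proof. by rewrite pair_big; apply: eq_bigr => -[]. Qed.

Lemma psdZ m c (A : 'M[C]_m) : 0 <= c -> psd A -> psd (c *: A).
Proof.
by move=> c0 pA u; rewrite -scalemxAr -scalemxAl mxE mulr_ge0 //; exact: pA.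
Qed.

Lemma psd_sum m (I : finType) (A : I -> 'M[C]_m) :
  (forall i, psd (A i)) -> psd (\sum_i A i).
Proof.
move=> pA u; rewrite mulmx_sumr mulmx_suml summxE sumr_ge0 // => i _; exact: pA.
Qed.

Lemma psdD m (A B : 'M[C]_m) : psd A -> psd B -> psd (A + B).
Proof. by move=> pA pB u; rewrite mulmxDr mulmxDl mxE addr_ge0. Qed.

Lemma psd_conj m k (K : 'M[C]_(k, m)) (A : 'M[C]_k) : psd A -> psd (K ^t* *m A *m K).
Proof.
move=> pA u; have := pA (u *m K ^t*).
by rewrite trmx_mul map_mxM /= trmxCK !mulmxA.
Qed.

Lemma mxtrace_proj m (v : 'rV[C]_m) : \tr (proj v) = ip v v.
Proof. by rewrite /proj mxtrace_mulC /mxtrace big_ord1. Qed.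

Lemma mxtraceE m (A : 'M[C]_m) : psd A -> \tr A = (\sum_j ev A j)%:C.
Proof.
move=> pA; rewrite [in LHS](psdE pA) raddf_sum rmorph_sum; apply: eq_bigr => j _ /=.
by rewrite mxtraceZ mxtrace_proj ip_evec mulr1.
Qed.

Lemma mxtrace_expect m (A B : 'M[C]_m) : psd A ->
  \tr A = (\sum_j expect (evec B j) A)%:C.
Proof.
move=> pA; rewrite mxtraceE //; congr (_%:C).
under [RHS]eq_bigr do rewrite (expect_sum_proj _ (psdE pA)).
rewrite exchange_big; apply: eq_bigr => j _; rewrite -mulr_sumr.
by under eq_bigr do rewrite ip2C; rewrite parseval_evec ?mulr1 ?ip_evec.
Qed.

(** The spectral decompositions of all [X i], taken together, form an ensemble for the sum. *)
Lemma entropy_sum_le m (I : finType) (X : I -> 'M[C]_m) : (forall i, psd (X i)) ->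
  entropy (\sum_i X i) <= \sum_i entropy (X i).
Proof.
move=> pX.
have -> : \sum_i entropy (X i) = \sum_(a : I * 'I_m) entf (ev (X a.1) a.2).
  by rewrite big_pair; apply: eq_bigr => i _; rewrite entropyE.
apply: (@entropy_le_ensemble _ _ _ _ (fun a => evec (X a.1) a.2)) => [|a|a|].
- exact: psd_sum.
- exact: ev_ge0.
- exact: ip_evec.
by rewrite big_pair; apply: eq_bigr => i _; exact: psdE.
Qed.

Lemma entropyD_le m (X Y : 'M[C]_m) : psd X -> psd Y ->
  entropy (X + Y) <= entropy X + entropy Y.
Proof.
move=> pX pY; have := @entropy_sum_le m bool (fun b => if b then X else Y).
by rewrite !big_bool; apply; case.
Qed.

Lemma expectD m (u : 'rV[C]_m) A B : expect u (A + B) = expect u A + expect u B.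
Proof. by rewrite /expect mulmxDr mulmxDl mxE raddfD. Qed.

(** In the eigenbasis of [X + Y], the diagonals of [X] and [Y] have at least the entropies of [X]
    and [Y]; the scalar inequality then applies to each eigenvalue of the sum. *)
Lemma entropyD_ge m (X Y : 'M[C]_m) : psd X -> psd Y ->
  entropy X + entropy Y - complex.Re (\tr (X + Y)) * ln 2 <= entropy (X + Y).
Proof.
move=> pX pY; have pXY := psdD pX pY.
rewrite (mxtrace_expect (X + Y) pXY) (entropyE pXY) /=.
apply: le_trans (lerB (lerD (entropy_le_expect (X + Y) pX)
  (entropy_le_expect (X + Y) pY)) (lexx _)) _.
rewrite -big_split mulr_suml -sumrB; apply: ler_sum => j _.
by rewrite ev_expect // expectD entfD_ge // expect_ge0.
Qed.

(** Sum the tangent bound [entf_le] over the [m] eigenvalues. At trace one this is [ln m]; the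
    general form also serves unnormalized blocks. *)
Lemma entropy_le_ln m (A : 'M[C]_m) : (0 < m)%N -> psd A ->
  entropy A <= complex.Re (\tr A) * ln m%:R - complex.Re (\tr A) + 1.
Proof.
move=> m0 pA; rewrite entropyE // mxtraceE //=.
have mR : 0 < m%:R :> R by rewrite ltr0n.
apply: le_trans (_ : \sum_(j < m) (ev A j * ln m%:R - ev A j + m%:R^-1) <= _).
  by apply: ler_sum => j _; rewrite entf_le ?ev_ge0.
rewrite big_split sumrB -mulr_suml /= lerD2l sumr_const card_ord -[_^-1 *+ m]mulr_natl.
by rewrite mulfV ?gt_eqF.
Qed.

Lemma entropy_ge0 m (A : 'M[C]_m) : psd A -> complex.Re (\tr A) <= 1 -> 0 <= entropy A.
Proof.
move=> pA; rewrite mxtraceE //= => tA; rewrite entropyE // sumr_ge0 // => j _.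
rewrite entf_ge0 // ev_ge0 //=; apply: le_trans tA.
by rewrite (bigD1 j) //= lerDl sumr_ge0 // => k _; exact: ev_ge0.
Qed.

Lemma entropyZ m c (A : 'M[C]_m) : 0 <= c -> psd A ->
  entropy (c%:C *: A) = c * entropy A + complex.Re (\tr A) * entf c.
Proof.
move=> c0 pA.
rewrite (@entropy_orthonormal _ _ _ (fun j => c * ev A j) (evec A)) //; first last.
- by rewrite [in LHS](psdE pA) scaler_sumr; apply: eq_bigr => j _; rewrite scalerA rmorphM.
- exact: evec_orthonormal.
- by move=> j; rewrite mulr_ge0 ?ev_ge0.
rewrite entropyE // mxtraceE //= mulr_sumr mulr_suml -big_split; apply: eq_bigr => j _ /=.
by rewrite entfM ?ev_ge0.
Qed.

(** * Product vectors and classical-quantum operators *)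

Lemma projE m (v : 'rV[C]_m) i j : proj v i j = (v 0 i)^* * v 0 j.
Proof. by rewrite mxE big_ord1 !mxE. Qed.

(** The product vector [v *t g], typed as a row instead of a matrix with [1 * 1] rows. *)
Definition tensrow a b (v : 'rV[C]_a) (g : 'rV[C]_b) : 'rV[C]_(a * b) :=
  \row_k (v 0 (mxtens_unindex k).1 * g 0 (mxtens_unindex k).2).

Lemma proj_tensrow a b (v : 'rV[C]_a) (g : 'rV[C]_b) :
  proj (tensrow v g) = proj v *t proj g.
Proof.
by apply/matrixP => i j; rewrite projE [RHS]mxE !projE !mxE rmorphM mulrACA.
Qed.

Lemma ip_tensrow a b (v w : 'rV[C]_a) (g h : 'rV[C]_b) :
  ip (tensrow v g) (tensrow w h) = ip v w * ip g h.
Proof.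
rewrite !ipE mulr_sum; apply: eq_bigr => k _.
by rewrite !mxE rmorphM mulrACA.
Qed.

Lemma tensmx_sumZl a b (I : finType) (c : I -> C) (A : I -> 'M[C]_a) (B : 'M[C]_b) :
  (\sum_i c i *: A i) *t B = \sum_i c i *: (A i *t B).
Proof.
apply/matrixP => p q; rewrite summxE mxE summxE mulr_suml.
by apply: eq_bigr => i _; rewrite !mxE mulrA.
Qed.

(** Eigenvectors of [Y i] tensored with [g i] are jointly orthonormal, so the spectrum is the union
    of the spectra. The [Y i] carry their own weights, hence no separate Shannon term appears. *)
Lemma entropy_cq a b (I : finType) (Y : I -> 'M[C]_a) (g : I -> 'rV[C]_b) :
  (forall i, psd (Y i)) -> orthonormal g ->
  entropy (\sum_i Y i *t proj (g i)) = \sum_i entropy (Y i).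
Proof.
move=> pY og.
have -> : \sum_i entropy (Y i) = \sum_(k : I * 'I_a) entf (ev (Y k.1) k.2).
  by rewrite big_pair; apply: eq_bigr => i _; rewrite entropyE.
apply: (@entropy_orthonormal _ _ _ _
  (fun k => tensrow (evec (Y k.1) k.2) (g k.1))) => [k|k l|].
- exact: ev_ge0.
- rewrite ip_tensrow og -pair_eqE /=; case: k l => [i j] [i' j'] /=.
  case: eqP => [<-|]; last by rewrite mulr0.
  by rewrite evec_orthonormal mulr1.
rewrite big_pair; apply: eq_bigr => i _; rewrite [in LHS](psdE (pY i)) tensmx_sumZl.
by apply: eq_bigr => j _; rewrite proj_tensrow.
Qed.

End Entropy.

(** * Maps acting on one tensor factor *)

Section Maps.
Variable R : realType.
Local Notation C := R[i].

Lemma big_mxtens_index (V : nmodType) a b (F : 'I_(a * b) -> V) :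
  \sum_s F s = \sum_i \sum_k F (mxtens_index (i, k)).
Proof.
rewrite pair_big /= (reindex (@mxtens_index a b)) /=; last first.
  by exists (@mxtens_unindex a b) => i _; rewrite (mxtens_indexK, mxtens_unindexK).
by apply: eq_bigr => -[i k].
Qed.

(** Since [X] is the sum of the [|i><j| (x) tblock X i j], the map [id (x) f] acts block by
    block. *)
Definition tblock a b (X : 'M[C]_(a * b)) (i j : 'I_a) : 'M[C]_b :=
  \matrix_(k, l) X (mxtens_index (i, k)) (mxtens_index (j, l)).

Lemma eq_mxtens a b c d (X Y : 'M[C]_(a * b, c * d)) :
  (forall i k j l, X (mxtens_index (i, k)) (mxtens_index (j, l)) =
                   Y (mxtens_index (i, k)) (mxtens_index (j, l))) -> X = Y.
Proof.
move=> h; apply/matrixP => p q.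
by case: (mxtens_indexP p) => i k; case: (mxtens_indexP q) => j l.
Qed.

Lemma tensmap_idE a b c (f : 'M[C]_b -> 'M[C]_c) (X : 'M[C]_(a * b)) i p j q :
  linear f ->
  tensmap id f X (mxtens_index (i, p)) (mxtens_index (j, q)) = f (tblock X i j) p q.
Proof.
move=> lf; rewrite /tensmap summxE (bigD1 i) //= [X in _ + X]big1 ?addr0; last first.
  move=> i' ii; rewrite summxE big1 // => j' _; rewrite summxE big1 // => k _.
  rewrite summxE big1 // => l _.
  by rewrite mxE tensmxE mxE eq_sym (negbTE ii) mul0r mulr0.
rewrite summxE (bigD1 j) //= [X in _ + X]big1 ?addr0; last first.
  move=> j' jj; rewrite summxE big1 // => k _; rewrite summxE big1 // => l _.
  by rewrite mxE tensmxE mxE [j == _]eq_sym (negbTE jj) andbF mul0r mulr0.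
rewrite (linear_deltaE lf) !summxE; apply: eq_bigr => k _.
rewrite !summxE; apply: eq_bigr => l _.
rewrite [LHS]mxE tensmxE [delta_mx i j i j]mxE !eqxx mul1r [RHS]mxE; congr (_ * _).
by rewrite mxE.
Qed.

Lemma tblock_tensmap a b c (f : 'M[C]_b -> 'M[C]_c) (X : 'M[C]_(a * b)) i j :
  linear f -> tblock (tensmap id f X) i j = f (tblock X i j).
Proof. by move=> lf; apply/matrixP => p q; rewrite mxE tensmap_idE. Qed.

Lemma tensmap_id_comp a b c d (f : 'M[C]_c -> 'M[C]_d) (g : 'M[C]_b -> 'M[C]_c)
    (X : 'M[C]_(a * b)) : linear f -> linear g ->
  tensmap id (f \o g) X = tensmap id f (tensmap id g X).
Proof.
move=> lf lg; have lfg : linear (f \o g) by move=> k u v; rewrite /= lg lf.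
by apply: eq_mxtens => i p j q; rewrite !tensmap_idE //= tblock_tensmap.
Qed.

Lemma ptrace2_tensmap a b c (f : 'M[C]_b -> 'M[C]_c) (X : 'M[C]_(a * b)) :
  linear f -> (forall A, \tr (f A) = \tr A) ->
  ptrace2 (tensmap id f X) = ptrace2 X.
Proof.
move=> lf tf; apply/matrixP => i j; rewrite !mxE.
transitivity (\tr (f (tblock X i j))); first by apply: eq_bigr => k _; rewrite tensmap_idE.
by rewrite tf; apply: eq_bigr => k _; rewrite mxE.
Qed.

Lemma mxtrace_ptrace2 a b (X : 'M[C]_(a * b)) : \tr (ptrace2 X) = \tr X.
Proof. by rewrite /mxtrace big_mxtens_index; apply: eq_bigr => i _; rewrite mxE. Qed.

Lemma mxtrace_ptrace1 a b (X : 'M[C]_(a * b)) : \tr (ptrace1 X) = \tr X.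
Proof.
rewrite /mxtrace big_mxtens_index exchange_big.
by apply: eq_bigr => i _; rewrite mxE.
Qed.

Lemma linear_sum_fun b c (f : 'M[C]_b -> 'M[C]_c) (I : finType) (F : I -> 'M[C]_b) :
  linear f -> f (\sum_i F i) = \sum_i f (F i).
Proof.
move=> lf; have f0 : f 0 = 0.
  by have := lf (-1) 0 0; rewrite scaler0 addr0 scaleN1r addNr.
have fD u v : f (u + v) = f u + f v by have := lf 1 u v; rewrite !scale1r.
by rewrite (big_morph f fD f0).
Qed.

Lemma ptrace1_tensmap a b c (f : 'M[C]_b -> 'M[C]_c) (X : 'M[C]_(a * b)) :
  linear f -> ptrace1 (tensmap id f X) = f (ptrace1 X).
Proof.
move=> lf.
have E d (Y : 'M[C]_(a * d)) : ptrace1 Y = \sum_i tblock Y i i.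
  by apply/matrixP => k l; rewrite summxE mxE; apply: eq_bigr => i _; rewrite mxE.
by rewrite !E linear_sum_fun //; apply: eq_bigr => i _; rewrite tblock_tensmap.
Qed.

(** Keeping the weights [c] apart avoids square roots. As vectors are rows, [K] acts by right
    multiplication, and trace preservation reads: the weighted sum of [K a *m (K a) ^t*] is the
    identity. *)
Definition kraus k m (I : finType) (c : I -> R) (K : I -> 'M[C]_(k, m))
    (X : 'M[C]_k) : 'M[C]_m := \sum_a (c a)%:C *: ((K a) ^t* *m X *m K a).

Lemma kraus_linear k m (I : finType) (c : I -> R) (K : I -> 'M[C]_(k, m)) :
  linear (kraus c K).
Proof.
move=> x u v; rewrite /kraus scaler_sumr -big_split; apply: eq_bigr => a _ /=.
rewrite mulmxDr mulmxDl scalerDr -scalemxAr -scalemxAl !scalerA; congr (_ *: _ + _).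
by rewrite mulrC.
Qed.

Lemma psd_kraus k m (I : finType) (c : I -> R) (K : I -> 'M[C]_(k, m)) X :
  (forall a, 0 <= c a) -> psd X -> psd (kraus c K X).
Proof.
move=> c0 pX; apply: psd_sum => a; apply: psdZ; rewrite ?ler0c //.
exact: psd_conj.
Qed.

Lemma mul_tens1mxE a k m p (K : 'M[C]_(k, m)) (X : 'M[C]_(p, a * k)) u j q :
  (X *m (1%:M *t K)) u (mxtens_index (j, q)) = \sum_l X u (mxtens_index (j, l)) * K l q.
Proof.
rewrite mxE big_mxtens_index (bigD1 j)//= [X in _ + X]big1 ?addr0 => [|i ij].
  by apply: eq_bigr => l _; rewrite tensmxE mxE eqxx mul1r.
by apply: big1 => l _; rewrite tensmxE mxE (negbTE ij) mul0r mulr0.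
Qed.

Lemma tens_conjtr a b c d (A : 'M[C]_(a, b)) (B : 'M[C]_(c, d)) :
  (A *t B) ^t* = A ^t* *t B ^t*.
Proof. by rewrite trmx_tens map_mxT. Qed.

Lemma mul_tens1mx_ctE a k m p (K : 'M[C]_(k, m)) (X : 'M[C]_(a * k, p)) u j q :
  ((1%:M *t K) ^t* *m X) (mxtens_index (j, q)) u =
  \sum_l (K l q)^* * X (mxtens_index (j, l)) u.
Proof.
rewrite tens_conjtr mxE big_mxtens_index (bigD1 j)//= [X in _ + X]big1 ?addr0 => [|i ij].
  by apply: eq_bigr => l _; rewrite tensmxE !mxE eqxx conjC1 mul1r.
by apply: big1 => l _; rewrite tensmxE !mxE (negbTE ij) conjC0 !mul0r.
Qed.

Lemma tensmap_kraus a k m (I : finType) (c : I -> R) (K : I -> 'M[C]_(k, m))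
    (X : 'M[C]_(a * k)) :
  tensmap id (kraus c K) X = kraus c (fun b => 1%:M *t K b) X.
Proof.
apply: eq_mxtens => i p j q; rewrite tensmap_idE; last exact: kraus_linear.
rewrite !summxE; apply: eq_bigr => b _; rewrite [LHS]mxE [RHS]mxE; congr (_ * _).
rewrite mul_tens1mxE mxE; apply: eq_bigr => l _; congr (_ * _).
rewrite mul_tens1mx_ctE mxE; apply: eq_bigr => l' _.
by rewrite !mxE.
Qed.

Lemma kraus_channel k m (I : finType) (c : I -> R) (K : I -> 'M[C]_(k, m)) :
  (forall a, 0 <= c a) -> \sum_a (c a)%:C *: (K a *m (K a) ^t*) = 1%:M ->
  is_channel (kraus c K).
Proof.
move=> c0 K1; split; first exact: kraus_linear.
  by move=> j X pX; rewrite tensmap_kraus; exact: psd_kraus.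
move=> A; rewrite -[in RHS](mulmx1 A) -K1 mulmx_sumr !raddf_sum; apply: eq_bigr => a _ /=.
by rewrite -scalemxAr !mxtraceZ -mulmxA mxtrace_mulC !mulmxA.
Qed.

(** The unnormalized state of the first factor when measuring the second one in the standard basis
    gives [k]. *)
Definition ptblock a b (X : 'M[C]_(a * b)) (k : 'I_b) : 'M[C]_a :=
  \matrix_(i, j) X (mxtens_index (i, k)) (mxtens_index (j, k)).

Lemma ptrace2E a b (X : 'M[C]_(a * b)) : ptrace2 X = \sum_k ptblock X k.
Proof. by apply/matrixP => i j; rewrite summxE mxE; apply: eq_bigr => k _; rewrite mxE. Qed.

Lemma psd_ptblock a b (X : 'M[C]_(a * b)) k : psd X -> psd (ptblock X k).
Proof.
move=> pX u; have := pX (tensrow u (delta_mx 0 k)).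
have E j : tensrow u (delta_mx 0 k) 0 (mxtens_index j) = u 0 j.1 * (j.2 == k)%:R.
  by rewrite mxE mxtens_indexK mxE eqxx.
suff -> : (tensrow u (delta_mx 0 k) *m X *m (tensrow u (delta_mx 0 k)) ^t*) 0 0
  = (u *m ptblock X k *m u ^t*) 0 0 by [].
rewrite !mxE big_mxtens_index; apply: eq_bigr => i _.
rewrite (bigD1 k)//= [X in _ + X]big1 ?addr0 => [|l lk]; last first.
  by rewrite ![(_ ^t*) _ _]mxE [_^T _ _]mxE E /= (negbTE lk) mulr0 conjC0 mulr0.
rewrite ![(_ ^t*) _ _]mxE ![_^T _ _]mxE E /= eqxx mulr1; congr (_ * _).
rewrite !mxE big_mxtens_index; apply: eq_bigr => j _.
rewrite (bigD1 k)//= [X in _ + X]big1 ?addr0 => [|l lk]; last first.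
  by rewrite E /= (negbTE lk) mulr0 mul0r.
by rewrite E /= eqxx mulr1 mxE.
Qed.

(** Measure and prepare: the second factor is found in state [k] and replaced by [g]. This is how
    the noisy branches produce classical-quantum operators. *)
Lemma kraus_ketbra_tens a b m (X : 'M[C]_(a * b)) (k : 'I_b) (g : 'rV[C]_m) :
  (1%:M *t (delta_mx k 0 *m g)) ^t* *m X *m (1%:M *t (delta_mx k 0 *m g)) =
  ptblock X k *t proj g.
Proof.
have E l q : (delta_mx k 0 *m g) l q = (l == k)%:R * g 0 q.
  by rewrite mxE big_ord1 mxE eqxx andbT.
apply: eq_mxtens => i p j q; rewrite tensmxE projE mul_tens1mxE mxE.
rewrite (bigD1 k)//= [X in _ + X]big1 ?addr0 => [|l lk]; last first.
  by rewrite E (negbTE lk) mul0r mulr0.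
rewrite E eqxx mul1r mulrA; congr (_ * _).
rewrite mul_tens1mx_ctE (bigD1 k)//= [X in _ + X]big1 ?addr0 => [|l lk]; last first.
  by rewrite E (negbTE lk) mul0r conjC0 mul0r.
by rewrite E eqxx mul1r mulrC.
Qed.

Lemma psd_ptrace1 a b (X : 'M[C]_(a * b)) : psd X -> psd (ptrace1 X).
Proof.
move=> pX.
(* [L i] is [<i| (x) 1], so the partial trace is a sum of congruences. *)
pose L i : 'M[C]_(b, a * b) := \matrix_(k, p) ((i, k) == mxtens_unindex p)%:R.
have -> : ptrace1 X = \sum_i L i *m X *m (L i) ^t*.
  apply/matrixP => k l; rewrite summxE mxE; apply: eq_bigr => i _.
  rewrite mxE (bigD1 (mxtens_index (i, l)))//= [X in _ + X]big1 ?addr0 => [|p pl]; last first.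
    rewrite !mxE; case: eqP => [e|_]; last by rewrite conjC0 mulr0.
    by case/eqP: pl; rewrite e mxtens_unindexK.
  rewrite !mxE mxtens_indexK eqxx conjC1 mulr1.
  rewrite (bigD1 (mxtens_index (i, k)))//= [X in _ + X]big1 ?addr0 => [|p pl]; last first.
    rewrite !mxE; case: eqP => [e|_]; last by rewrite mul0r.
    by case/eqP: pl; rewrite e mxtens_unindexK.
  by rewrite !mxE mxtens_indexK eqxx mul1r.
apply: psd_sum => i; rewrite -[X in X *m _ *m _]trmxCK; exact: psd_conj.
Qed.

End Maps.

(** * The channel *)

Section Channel.
Variable R : realType.
Local Notation C := R[i].

Lemma big_I2 (V : nmodType) (F : 'I_2 -> V) : \sum_b F b = F 0 + F 1.
Proof.
by rewrite !big_ord_recl big_ord0 addr0; congr (F _ + F _); exact: val_inj.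
Qed.

Lemma ip_delta m (i j : 'I_m) : ip (delta_mx 0 i : 'rV[C]_m) (delta_mx 0 j) = (i == j)%:R.
Proof.
rewrite ipE (bigD1 i)//= [X in _ + X]big1 ?addr0 => [|k ki].
  by rewrite !mxE !eqxx mul1r conjC_nat.
by rewrite !mxE (negbTE ki) andbF mul0r.
Qed.

Lemma orthonormal_delta m (I : finType) (f : I -> 'I_m) : injective f ->
  orthonormal (fun a => delta_mx 0 (f a) : 'rV[C]_m).
Proof. by move=> fI a b; rewrite ip_delta (inj_eq fI). Qed.

Lemma sum_proj_delta m : \sum_s proj (delta_mx 0 s : 'rV[C]_m) = 1%:M.
Proof.
apply/matrixP => i j; rewrite summxE (bigD1 i)//= [X in _ + X]big1 ?addr0 => [|k ki].
  by rewrite projE !mxE !eqxx conjC1 mul1r eq_sym.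
by rewrite projE !mxE [i == k]eq_sym (negbTE ki) conjC0 mul0r.
Qed.

Lemma ketbra_conj m p (X : 'M[C]_m) (k : 'I_m) (g : 'rV[C]_p) :
  (delta_mx k 0 *m g) ^t* *m X *m (delta_mx k 0 *m g) = X k k *: proj g.
Proof.
rewrite trmx_mul map_mxM /= !mulmxA -[_ *m X]mulmxA -[_ *m _ *m delta_mx k 0]mulmxA.
rewrite [X in _ *m X *m _]mx11_scalar mul_mx_scalar -scalemxAl; congr (_ *: _).
rewrite mxE (bigD1 k)//= [X in _ + X]big1 ?addr0 => [|l lk]; last first.
  by rewrite !mxE (negbTE lk) /= mulr0.
rewrite !mxE eqxx mulr1 (bigD1 k)//= [X in _ + X]big1 ?addr0 => [|l lk]; last first.
  by rewrite !mxE (negbTE lk) conjC0 mul0r.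
by rewrite !mxE eqxx conjC1 mul1r.
Qed.

Lemma ketbra_mulct m p (k : 'I_m) (g : 'rV[C]_p) :
  (delta_mx k 0 *m g) *m (delta_mx k 0 *m g) ^t* = ip g g *: proj (delta_mx 0 k).
Proof.
rewrite trmx_mul map_mxM /= mulmxA -[_ *m g *m _]mulmxA.
rewrite [X in _ *m X *m _]mx11_scalar mul_mx_scalar -scalemxAl -/(ip g g).
suff -> : (delta_mx k 0 : 'cV[C]_m) *m (delta_mx k 0) ^t* = proj (delta_mx 0 k) :> 'M[C]_m by [].
apply/matrixP => i j; rewrite projE mxE big_ord1 !mxE.
by rewrite !conjC_nat !eqxx !andbT.
Qed.

Section Def.
Variable n : nat.

Definition bvec (b : 'I_2) (i : 'I_n) : 'rV[C]_(2 * n) := delta_mx 0 (mxtens_index (b, i)).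

Definition flag0 : 'M[C]_(2 * n) := \sum_k proj (bvec 0 k).

(* The input qubit is a flag, which is measured. On flag 0 the system is
   depolarized with probability 1/3, on flag 1 it is dephased; the output flag
   is always 0. With r = sqrt n, the weight 2/3 makes both branches equally good
   for one copy: (2/3) (ln n + ln r) = ln n. *)
Definition chan_weight (a : unit + ('I_n * 'I_n + 'I_n)) : R :=
  match a with inl _ => 2 / 3 | inr (inl _) => (3 * n%:R)^-1 | inr (inr _) => 1 end.

(** The three cases keep the system on flag 0, move [|0,k>] to [|0,l>], and move [|1,i>] to [|0,i>].
    Uniform weight over all [(k, l)] amounts to replacing the system by the uniform mixture. *)
Definition chan_kraus (a : unit + ('I_n * 'I_n + 'I_n)) : 'M[C]_(2 * n) :=
  match a with
  | inl _ => flag0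
  | inr (inl p) => delta_mx (mxtens_index (0, p.1)) 0 *m bvec 0 p.2
  | inr (inr i) => delta_mx (mxtens_index (1, i)) 0 *m bvec 0 i
  end.

Definition chan : 'M[C]_(2 * n) -> 'M[C]_(2 * n) := kraus chan_weight chan_kraus.

Lemma chan_weight_ge0 a : 0 <= chan_weight a.
Proof. by case: a => [_|[_|_]] /=; rewrite ?divr_ge0 ?invr_ge0 ?mulr_ge0. Qed.

Lemma bvec_orthonormal b : orthonormal (bvec b).
Proof.
apply: (@orthonormal_delta _ _ (fun i => mxtens_index (b, i))) => i j.
by move/(can_inj (@mxtens_indexK _ _)) => [].
Qed.

Lemma ip_bvec b i : ip (bvec b i) (bvec b i) = 1.
Proof. by rewrite bvec_orthonormal eqxx. Qed.

Lemma proj_mul m (u v : 'rV[C]_m) : proj u *m proj v = ip u v *: (u ^t* *m v).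
Proof.
rewrite /proj mulmxA -[u ^t* *m u *m _]mulmxA [X in _ *m X *m _]mx11_scalar.
by rewrite mul_mx_scalar -scalemxAl.
Qed.

Lemma proj_ct m (u : 'rV[C]_m) : (proj u) ^t* = proj u.
Proof. by rewrite /proj trmx_mul map_mxM /= trmxCK. Qed.

Lemma flag0_ct : flag0 ^t* = flag0.
Proof.
by rewrite /flag0 raddf_sum /= map_mx_sum; apply: eq_bigr => k _; rewrite proj_ct.
Qed.

Lemma flag0_idem : flag0 *m flag0 = flag0.
Proof.
rewrite {1}/flag0 mulmx_suml; apply: eq_bigr => k _.
rewrite mulmx_sumr (bigD1 k)//= [X in _ + X]big1 ?addr0 => [|l lk].
  by rewrite proj_mul ip_bvec scale1r.
by rewrite proj_mul bvec_orthonormal eq_sym (negbTE lk) scale0r.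
Qed.

Lemma chan_channel : (0 < n)%N -> is_channel chan.
Proof.
move=> n0; apply: kraus_channel; first exact: chan_weight_ge0.
rewrite big_sumType /= (big_pred1 tt) => [|[]] //=; rewrite flag0_ct flag0_idem.
rewrite big_sumType /= -sum_proj_delta big_mxtens_index big_I2 addrA; congr (_ + _).
  rewrite big_pair /=.
  have -> : \sum_k proj (delta_mx 0 (mxtens_index (0 : 'I_2, k))) = flag0 by [].
  (* For each [k] the [n] targets contribute [n / (3 * n) = 1 / 3], the complement of the weight
     [2 / 3]. *)
  under eq_bigr => k _.
    under eq_bigr do rewrite ketbra_mulct ip_bvec scale1r.
    rewrite sumr_const card_ord -scaler_nat scalerA.
    over.
  rewrite -scaler_sumr -/flag0 -scalerDl -[RHS]scale1r; congr (_ *: _).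
  rewrite -(rmorph_nat (real_complex R)) -rmorphM -rmorphD; congr (_%:C).
  by field; rewrite pnatr_eq0 -lt0n.
by apply: eq_bigr => i _; rewrite ketbra_mulct ip_bvec !scale1r.
Qed.

End Def.

End Channel.

(** * Upper bound for one copy *)

Section UpperBound.
Variable R : realType.
Local Notation C := R[i].

Section Upper.
Variables n r : nat.
Hypothesis n0 : (0 < n)%N.
Hypothesis nr : n = (r ^ 2)%N.

Lemma Re_mxtrace_ge0 m (A : 'M[C]_m) : psd A -> 0 <= complex.Re (\tr A).
Proof. by move=> pA; rewrite mxtraceE //= sumr_ge0 // => j _; exact: ev_ge0. Qed.

(** Flag 0 undisturbed, flag 0 depolarized, flag 1 dephased. The last two are in the form required
    by [entropy_cq]. *)
Lemma tensmap_chan a (X : 'M[C]_(a * (2 * n))) :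
  tensmap id (@chan R n) X =
    (2 / 3)%:C *: ((1%:M *t flag0 R n) ^t* *m X *m (1%:M *t flag0 R n))
    + (\sum_l (((3 * n%:R)^-1)%:C *: \sum_k ptblock X (mxtens_index (0, k)))
          *t proj (bvec R 0 l)
       + \sum_i ptblock X (mxtens_index (1, i)) *t proj (bvec R 0 i)).
Proof.
rewrite tensmap_kraus /kraus big_sumType /= (big_pred1 tt) => [|[]] //=; congr (_ + _).
rewrite big_sumType /=; congr (_ + _).
  rewrite big_pair exchange_big; apply: eq_bigr => l _ /=.
  under eq_bigr do rewrite kraus_ketbra_tens.
  apply/matrixP => p q; rewrite summxE [RHS]mxE [X in _ = X * _]mxE summxE mulr_sumr mulr_suml.
  by apply: eq_bigr => k _; rewrite [LHS]mxE [X in _ * X]mxE mulrA.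
by apply: eq_bigr => i _; rewrite kraus_ketbra_tens scale1r.
Qed.

Lemma psd_tens_proj a m (A : 'M[C]_a) (g : 'rV[C]_m) : psd A -> psd (A *t proj g).
Proof.
move=> pA; have -> : A *t proj g = \sum_j (ev A j)%:C *: proj (tensrow (evec A j) g).
  rewrite [in LHS](psdE pA) tensmx_sumZl.
  by apply: eq_bigr => j _; rewrite proj_tensrow.
by apply: psd_sum_proj => j; exact: ev_ge0.
Qed.

(** The first marginal splits by the flag into [A1 + A2]. Dephasing gives
    [entropy A2 <= entropy Y3]. As [A1] has dimension [r], two thirds of its entropy are at most
    [a / 3 * ln n] up to a constant, so [entropy Y2] compensates for [entropy A1]. Superadditivity,
    used twice at a cost of at most [ln 2] each, recombines the branches; for [Y1], nonnegativity
    suffices. *)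
Lemma entropy_ptrace2_le (X : 'M[C]_(r * (2 * n))) : psd X -> \tr X = 1 ->
  entropy (ptrace2 X) <= entropy (tensmap id (@chan R n) X) + 2 * ln 2 + 1.
Proof.
move=> pX tX.
have nR : 0 < n%:R :> R by rewrite ltr0n.
have r0 : (0 < r)%N by move: n0; rewrite nr; case: (r).
have [lN _ tN] := chan_channel R n0.
have := ptrace2_tensmap X lN tN => /(congr1 mxtrace); rewrite !mxtrace_ptrace2 tX.
rewrite tensmap_chan.
set Y1 := _ *: (_ *m _ *m _); set Y2 := \sum_l _ *t _; set Y3 := \sum_i _ *t _ => trY.
pose A1 := \sum_k ptblock X (mxtens_index (0 : 'I_2, k)).
pose A2 := \sum_i ptblock X (mxtens_index (1 : 'I_2, i)).
have pA1 : psd A1 by apply: psd_sum => k; exact: psd_ptblock.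
have c0 : 0 <= (3 * n%:R : R)^-1 by rewrite invr_ge0 mulr_ge0.
have pcA1 : psd (((3 * n%:R)^-1)%:C *: A1) by apply: psdZ; rewrite ?ler0c.
have pY1 : psd Y1 by apply: psdZ; [rewrite ler0c divr_ge0|exact: psd_conj].
have pY2 : psd Y2 by apply: psd_sum => l; exact: psd_tens_proj.
have pY3 : psd Y3 by apply: psd_sum => i; apply: psd_tens_proj; exact: psd_ptblock.
have hA : entropy (ptrace2 X) <= entropy A1 + entropy A2.
  rewrite ptrace2E big_mxtens_index big_I2; apply: (entropyD_le pA1).
  by apply: psd_sum => k; exact: psd_ptblock.
have hY3 : entropy A2 <= entropy Y3.
  rewrite entropy_cq; [|by move=> i; exact: psd_ptblock|exact: bvec_orthonormal].
  by apply: entropy_sum_le => i; exact: psd_ptblock.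
pose a := complex.Re (\tr A1).
have a0 : 0 <= a by exact: Re_mxtrace_ge0.
(* [Y2] consists of [n] orthogonal copies of [A1], each scaled by [(3 * n)^-1]; the scaling produces
   the logarithms. *)
have hY2 : entropy Y2 = 3^-1 * entropy A1 + a / 3 * (ln 3 + ln n%:R).
  rewrite entropy_cq; [|by []|exact: bvec_orthonormal].
  rewrite sumr_const card_ord entropyZ // -/a -[_ *+ n]mulr_natl /entf.
  by rewrite lnV ?posrE ?mulr_gt0// lnM ?posrE//; field; rewrite gt_eqF.
have hA1 : entropy A1 <= a * ln r%:R - a + 1 by exact: entropy_le_ln.
(* The balance of the two branches: [2 / 3 * ln r = 1 / 3 * ln n]. *)
have lnn : ln n%:R = 2 * ln r%:R :> R.
  by rewrite nr natrX lnXn ?ltr0n// mulr_natl.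
have h1 := entropyD_ge pY1 (psdD pY2 pY3).
have h2 := entropyD_ge pY2 pY3.
have t1 := Re_mxtrace_ge0 pY1; have t23 := Re_mxtrace_ge0 (psdD pY2 pY3).
have tt : complex.Re (\tr Y1) + complex.Re (\tr (Y2 + Y3)) = 1.
  by rewrite -raddfD -mxtraceD trY.
rewrite trY /= mul1r in h1.
have h3 : 0 <= entropy Y1 by apply: entropy_ge0 => //; rewrite -tt lerDl.
have l2 : 0 <= ln 2 :> R by rewrite ln_ge0 // ler1n.
have l3 : 0 <= ln 3 :> R by rewrite ln_ge0 // ler1n.
have h4 : complex.Re (\tr (Y2 + Y3)) * ln 2 <= ln 2 by rewrite ler_piMl // -tt lerDr.
have h5 : 0 <= a * ln 3 by rewrite mulr_ge0.
rewrite lnn in hY2.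
move: (entropy (ptrace2 X)) (entropy A1) (entropy A2) (entropy Y1) (entropy Y2)
  (entropy Y3) (entropy (Y1 + (Y2 + Y3))) (entropy (Y2 + Y3))
  (complex.Re (\tr (Y2 + Y3))) hA hY3 hY2 hA1 h1 h2 h3 h4.
move: a (ln r%:R) (ln 2) (ln 3) a0 l2 l3 h5.
clear=> *; lra.
Qed.

(** Each entropy difference contributes at most [2 * ln 2 + 1] by [entropy_ptrace2_le], and the
    output has entropy at most [ln (2 * n)]. *)
Lemma Cprod_value_le N (lam : 'I_N -> R) (phi : 'I_N -> 'M[C]_r -> 'M[C]_(2 * n))
    (eta : 'I_N -> 'M[C]_(r * r)) :
  (forall i, 0 <= lam i) -> \sum_(i < N) lam i = 1 ->
  (forall i, is_channel (phi i)) -> (forall i, is_pure_state (eta i)) ->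
  Cprod_value (@chan R n) lam phi eta <= ln n%:R + 3 * ln 2 + 1.
Proof.
move=> lam0 lam1 hphi heta; rewrite /Cprod_value.
have [lN cN tN] := chan_channel R n0.
have step i : lam i * (entropy (ptrace2 (eta i))
    - entropy (tensmap id (@chan R n \o phi i) (eta i))) <= lam i * (2 * ln 2 + 1).
  have [lf cf tf] := hphi i; have [[pe te] _] := heta i.
  apply: ler_wpM2l => //; rewrite tensmap_id_comp //.
  (* The encoder acts on the second factor only, so [eta i] can be replaced by the encoded state,
     which has the same first marginal. *)
  rewrite -(ptrace2_tensmap (eta i) lf tf) lerBlDl addrA.
  apply: entropy_ptrace2_le; first exact: cf.
  by rewrite -mxtrace_ptrace2 ptrace2_tensmap // mxtrace_ptrace2.
have := ler_sum (index_enum _) (fun i (_ : xpredT i) => step i).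
rewrite -mulr_suml lam1 mul1r => h2.
set B := \sum_(i < N) _ *: _.
have pB : psd B.
  apply: psd_sum => i; have [lf cf tf] := hphi i; have [[pe te] _] := heta i.
  apply: psdZ; first by rewrite ler0c.
  rewrite -(ptrace1_tensmap (eta i) lf) -ptrace1_tensmap //.
  by apply: psd_ptrace1; apply: cN; apply: cf.
have tB : \tr B = 1.
  rewrite raddf_sum /= -[1](rmorph1 (real_complex R)) -lam1 rmorph_sum.
  apply: eq_bigr => i _; have [lf cf tf] := hphi i; have [[pe te] _] := heta i.
  by rewrite mxtraceZ tN tf mxtrace_ptrace1 te mulr1.
have := @entropy_le_ln _ _ B _ pB; rewrite tB /= muln_gt0 n0 => /(_ isT).
by rewrite natrM lnM ?posrE ?ltr0n //; move: h2 (entropy B) (ln n%:R) => *; lra.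
Qed.

End Upper.

End UpperBound.

(** * Lower bound for two copies *)

Section LowerBound.
Variable R : realType.
Local Notation C := R[i].

Lemma conj_proj k m (K : 'M[C]_(k, m)) (v : 'rV[C]_k) :
  K ^t* *m proj v *m K = proj (v *m K).
Proof. by rewrite /proj trmx_mul map_mxM /= !mulmxA. Qed.

Lemma conj_mxE k m (K : 'M[C]_(k, m)) (X : 'M[C]_k) s t :
  (K ^t* *m X *m K) s t = \sum_j \sum_i (K i s)^* * X i j * K j t.
Proof.
rewrite mxE; apply: eq_bigr => j _; rewrite mxE mulr_suml.
by apply: eq_bigr => i _; rewrite !mxE.
Qed.

(** [K *t g] with [k] instead of [k * 1] rows: a Kraus operator that applies [K] and prepares [g] in
    a second register. *)
Definition tensr k a b (K : 'M[C]_(k, a)) (g : 'rV[C]_b) : 'M[C]_(k, a * b) :=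
  \matrix_(i, p) (K i (mxtens_unindex p).1 * g 0 (mxtens_unindex p).2).

Lemma tensr_conj k a b (K : 'M[C]_(k, a)) (g : 'rV[C]_b) X :
  (tensr K g) ^t* *m X *m tensr K g = (K ^t* *m X *m K) *t proj g.
Proof.
apply: eq_mxtens => i p j q; rewrite tensmxE projE !conj_mxE mulr_suml.
apply: eq_bigr => t _; rewrite mulr_suml; apply: eq_bigr => s _.
by rewrite !mxE !mxtens_indexK /= rmorphM /=; ring.
Qed.

Lemma tensr_mulct k a b (K : 'M[C]_(k, a)) (g : 'rV[C]_b) :
  tensr K g *m (tensr K g) ^t* = ip g g *: (K *m K ^t*).
Proof.
apply/matrixP => i j; rewrite !mxE big_mxtens_index mulrC mulr_suml.
apply: eq_bigr => s _; rewrite ipE mulr_sumr; apply: eq_bigr => t _.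
by rewrite !mxE !mxtens_indexK /= rmorphM /=; ring.
Qed.

Lemma tensr_ketbra k a b (i : 'I_k) (v : 'rV[C]_a) (g : 'rV[C]_b) :
  tensr (delta_mx i 0 *m v) g = delta_mx i 0 *m tensrow v g.
Proof. by apply/matrixP => j p; rewrite !mxE !big_ord1 !mxE mulrA. Qed.

Lemma tens1mx1 a b : (1%:M : 'M[C]_a) *t (1%:M : 'M[C]_b) = 1%:M.
Proof.
apply: eq_mxtens => i p j q; rewrite tensmxE !mxE.
by rewrite (can_eq (@mxtens_indexK _ _)) -pair_eqE /= -natrM mulnb.
Qed.

Section Lower.
Variable n : nat.
Hypothesis n0 : (0 < n)%N.

Let nR : 0 < n%:R :> R. Proof. by rewrite ltr0n. Qed.
Let nR0 : n%:R != 0 :> R. Proof. by rewrite gt_eqF. Qed.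

(** * The maximally entangled input *)

Definition max_entangled : 'rV[C]_(n * n) :=
  \row_p (((Num.sqrt n%:R)^-1)%:C * ((mxtens_unindex p).1 == (mxtens_unindex p).2)%:R).

Lemma proj_max_entangledE i k j l :
  proj max_entangled (mxtens_index (i, k)) (mxtens_index (j, l)) =
  (n%:R^-1)%:C * ((i == k)%:R * (j == l)%:R).
Proof.
rewrite projE !mxE !mxtens_indexK /= rmorphM /= conjC_nat geC0_conj; last first.
  by rewrite ler0c invr_ge0 sqrtr_ge0.
rewrite mulrACA; congr (_ * _); rewrite -rmorphM -invfM -expr2 sqr_sqrtr // ltW.
Qed.

Lemma ptrace1_max_entangled : ptrace1 (proj max_entangled) = (n%:R^-1)%:C *: 1%:M.
Proof.
apply/matrixP => k l; rewrite !mxE; under eq_bigr do rewrite proj_max_entangledE.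
rewrite -mulr_sumr; congr (_ * _); rewrite (bigD1 k)//= big1 ?addr0 => [|i ik].
  by rewrite eqxx mul1r.
by rewrite (negbTE ik) mul0r.
Qed.

Lemma ptrace2_max_entangled : ptrace2 (proj max_entangled) = (n%:R^-1)%:C *: 1%:M.
Proof.
apply/matrixP => k l; rewrite !mxE; under eq_bigr do rewrite proj_max_entangledE.
rewrite -mulr_sumr; congr (_ * _); rewrite (bigD1 k)//= big1 ?addr0 => [|i ik].
  by rewrite eqxx mul1r eq_sym.
by rewrite [k == i]eq_sym (negbTE ik) mul0r.
Qed.

Lemma ip_max_entangled : ip max_entangled max_entangled = 1.
Proof.
rewrite -mxtrace_proj -mxtrace_ptrace1 ptrace1_max_entangled mxtraceZ mxtrace1.
by rewrite -(rmorph_nat (real_complex R)) -rmorphM mulVf.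
Qed.

Lemma psd_proj m (v : 'rV[C]_m) : psd (proj v).
Proof. by move=> u; rewrite sandwich_proj exprn_ge0. Qed.

Lemma max_entangled_pure : is_pure_state (proj max_entangled).
Proof.
have tr1 : \tr (proj max_entangled) = 1 by rewrite mxtrace_proj ip_max_entangled.
split; first by split=> //; exact: psd_proj.
apply/eqP; rewrite eqn_leq (leq_trans (mxrankM_maxr _ _) (rank_leq_row _)) /= lt0n mxrank_eq0.
apply/eqP => p0; move: tr1; rewrite p0 mxtrace0 => /esym/eqP; exact/negP/oner_neq0.
Qed.

(** The isometry [|k> -> |0,k>], which sets the flag to 0. *)
Definition emb : 'M[C]_(n, 2 * n) := \matrix_k bvec R 0 k.

Lemma embE k b i : emb k (mxtens_index (b, i)) = ((b == 0) && (i == k))%:R.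
Proof.
by rewrite !mxE eqxx /= (can_eq (@mxtens_indexK _ _)) -pair_eqE.
Qed.

Lemma emb_mulct : emb *m emb ^t* = 1%:M.
Proof.
apply/matrixP => i j; rewrite [RHS]mxE -(bvec_orthonormal R 0) ipE mxE.
by apply: eq_bigr => s _; rewrite !mxE.
Qed.

Lemma emb_ctmul : emb ^t* *m emb = flag0 R n.
Proof.
apply/matrixP => i j; rewrite /flag0 summxE mxE.
by apply: eq_bigr => k _; rewrite projE !mxE.
Qed.

Definition out_weight (a : unit + 'I_n * 'I_n) : R :=
  match a with inl _ => 2 / 3 | inr _ => (3 * n%:R)^-1 end.

Definition out_kraus (a : unit + 'I_n * 'I_n) : 'M[C]_(n, 2 * n) :=
  match a with inl _ => emb | inr p => delta_mx p.1 0 *m bvec R 0 p.2 end.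

(** With the flag set to 0 the dephasing operators contribute nothing, and the others become
    operators on the [n]-dimensional system. *)
Lemma chan_emb X : chan (emb ^t* *m X *m emb) = kraus out_weight out_kraus X.
Proof.
have E b k : (emb ^t* *m X *m emb) (mxtens_index (b, k)) (mxtens_index (b, k))
    = (b == 0)%:R * X k k.
  rewrite conj_mxE (bigD1 k)//= [X in _ + X]big1 ?addr0 => [|j jk]; last first.
    by apply: big1 => i _; rewrite !embE [k == j]eq_sym (negbTE jk) andbF mulr0.
  rewrite (bigD1 k)//= [X in _ + X]big1 ?addr0 => [|j jk]; last first.
    by rewrite !embE [k == j]eq_sym (negbTE jk) andbF conjC0 !mul0r.
  by rewrite !embE eqxx andbT conjC_nat; case: (b == 0); rewrite ?mul1r ?mulr1 ?mul0r.
rewrite /chan /kraus !big_sumType /= !(big_pred1 tt) => [|[]|[]] //=; congr (_ + _).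
  rewrite flag0_ct -emb_ctmul !mulmxA -(mulmxA _ emb (emb ^t*)) emb_mulct mulmx1.
  by rewrite -(mulmxA _ emb (emb ^t*)) emb_mulct mulmx1.
rewrite [X in _ + X]big1 ?addr0 => [|i _]; last first.
  by rewrite ketbra_conj E mul0r scale0r scaler0.
by apply: eq_bigr => p _; rewrite !ketbra_conj E eqxx mul1r.
Qed.

Lemma chan_bvec1 (i : 'I_n) : chan (proj (bvec R 1 i)) = proj (bvec R 0 i).
Proof.
have E b k : proj (bvec R 1 i) (mxtens_index (b, k)) (mxtens_index (b, k))
    = ((b == 1) && (k == i))%:R.
  rewrite projE !mxE /= (can_eq (@mxtens_indexK _ _)) -pair_eqE /= conjC_nat.
  by rewrite -natrM mulnb andbb.
rewrite /chan /kraus big_sumType /= (big_pred1 tt) => [|[]] //=.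
have -> : (flag0 R n) ^t* *m proj (bvec R 1 i) *m flag0 R n = 0.
  rewrite conj_proj (_ : bvec R 1 i *m _ = 0) ?/proj ?mulmx0 // mulmx_sumr big1 // => k _.
  rewrite /proj mulmxA [X in X *m _]mx11_scalar -/(ip _ _) ip_delta.
  by rewrite (can_eq (@mxtens_indexK _ _)) mul_scalar_mx scale0r.
rewrite scaler0 add0r big_sumType /= big1 ?add0r => [|p _]; last first.
  by rewrite ketbra_conj E scale0r scaler0.
rewrite (bigD1 i)//= big1 ?addr0 => [|k ki].
  by rewrite ketbra_conj E !eqxx !scale1r.
by rewrite ketbra_conj E (negbTE ki) andbF scale0r scaler0.
Qed.

(* The n-dimensional entanglement is spent on the depolarizing branch of the
   first copy; the second copy only transmits the classical letter i. *)
Definition encode (i : 'I_n) : 'M[C]_n -> 'M[C]_((2 * n) * (2 * n)) :=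
  kraus (fun _ : unit => 1) (fun _ => tensr emb (bvec R 1 i)).

Lemma encodeE i X : encode i X = (emb ^t* *m X *m emb) *t proj (bvec R 1 i).
Proof. by rewrite /encode /kraus (big_pred1 tt) => [|[]] //=; rewrite tensr_conj scale1r. Qed.

Lemma encode_channel i : is_channel (encode i).
Proof.
apply: kraus_channel => //; rewrite (big_pred1 tt) => [|[]] //=.
by rewrite tensr_mulct ip_bvec emb_mulct !scale1r.
Qed.

Lemma chan2_encodeE i X :
  tensmap (@chan R n) (@chan R n) (encode i X) =
  chan (emb ^t* *m X *m emb) *t proj (bvec R 0 i).
Proof.
have [lN _ _] := chan_channel R n0.
by rewrite encodeE tensmap_tens // chan_bvec1.
Qed.

Lemma chan2_encode i : tensmap (@chan R n) (@chan R n) \o encode i =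
  kraus out_weight (fun a => tensr (out_kraus a) (bvec R 0 i)).
Proof.
apply/funext => X /=; rewrite chan2_encodeE chan_emb /kraus tensmx_sumZl.
by apply: eq_bigr => a _; rewrite tensr_conj.
Qed.

(** The undisturbed part gives [2 / 3] and the depolarized part [1 / 3] of one and the same uniform
    mixture. *)
Lemma chan_emb_mixed : chan (emb ^t* *m ((n%:R^-1)%:C *: 1%:M) *m emb) =
  \sum_k (n%:R^-1)%:C *: proj (bvec R 0 k).
Proof.
rewrite chan_emb /kraus big_sumType /= (big_pred1 tt) => [|[]] //=.
rewrite -scalemxAr mulmx1 -scalemxAl emb_ctmul scalerA big_pair exchange_big /=.
under [X in _ + X]eq_bigr => l _.
  under eq_bigr do rewrite ketbra_conj !mxE eqxx mulr1 scalerA.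
  rewrite sumr_const card_ord -scaler_nat scalerA.
  over.
rewrite -!scaler_sumr -/(flag0 R n) -scalerDl; congr (_ *: _).
rewrite -(rmorph_nat (real_complex R)) -!rmorphM -rmorphD; congr (_%:C).
by field.
Qed.

(** * Entropies of the two-copy protocol *)

Lemma entf_inv (x : R) : 0 < x -> entf x^-1 = x^-1 * ln x.
Proof. by move=> x0; rewrite /entf lnV ?posrE// mulrN opprK. Qed.

Lemma entropy_mixed : entropy ((n%:R^-1)%:C *: 1%:M : 'M[C]_n) = ln n%:R.
Proof.
rewrite (@entropy_orthonormal _ _ _ (fun=> n%:R^-1) (fun s : 'I_n => delta_mx 0 s)).
- by rewrite sumr_const card_ord entf_inv // -[(_ * _) *+ _]mulr_natl mulrA mulfV // mul1r.
- by move=> _; rewrite invr_ge0 ltW.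
- exact: orthonormal_delta.
- by rewrite -sum_proj_delta scaler_sumr.
Qed.

(** The first copy outputs a uniform mixture and averaging over [i] makes the second one uniform
    too, so all [n * n] product vectors get equal weight. *)
Lemma entropy_output : entropy (\sum_(i < n) (n%:R^-1)%:C *:
    tensmap (@chan R n) (@chan R n) (encode i (ptrace1 (proj max_entangled)))) = 2 * ln n%:R.
Proof.
rewrite (@entropy_orthonormal _ _ _ (fun=> (n%:R * n%:R)^-1)
  (fun p : 'I_n * 'I_n => tensrow (bvec R 0 p.2) (bvec R 0 p.1))).
- rewrite sumr_const card_prod card_ord entf_inv ?mulr_gt0 // lnM ?posrE //.
  by rewrite -[(_ * _) *+ _]mulr_natl natrM; field.
- by move=> _; rewrite invr_ge0 mulr_ge0 // ltW.
- move=> [i j] [i' j'] /=; rewrite ip_tensrow !bvec_orthonormal -natrM mulnb andbC.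
  by rewrite -pair_eqE.
rewrite big_pair; apply: eq_bigr => i _ /=.
rewrite ptrace1_max_entangled chan2_encodeE chan_emb_mixed; apply/matrixP => p q.
rewrite summxE !mxE summxE mulr_suml mulr_sumr; apply: eq_bigr => k _.
by rewrite proj_tensrow !mxE invfM rmorphM /= !mulrA.
Qed.

(** With weight [2 / 3] the state stays pure, and the depolarized part is uniform over [n * n]
    product vectors. The pure vector may overlap them, so the ensemble bound is the right tool. *)
Lemma entropy_joint_le i :
  entropy (tensmap id (tensmap (@chan R n) (@chan R n) \o encode i) (proj max_entangled))
  <= 2 / 3 * ln n%:R + 1.
Proof.
rewrite chan2_encode tensmap_kraus.
pose t (a : unit + 'I_n * 'I_n) : R :=
  match a with inl _ => 2 / 3 | inr _ => (3 * (n%:R * n%:R))^-1 end.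
pose v (a : unit + 'I_n * 'I_n) : 'rV[C]_(n * ((2 * n) * (2 * n))) :=
  match a with
  | inl _ => max_entangled *m (1%:M *t tensr emb (bvec R 0 i))
  | inr p => tensrow (delta_mx 0 p.1) (tensrow (bvec R 0 p.2) (bvec R 0 i))
  end.
have nn0 : 0 < 3 * (n%:R * n%:R) :> R by rewrite !mulr_gt0.
apply: (@le_trans _ _ (\sum_a entf (t a))).
  apply: (entropy_le_ensemble (v := v)).
  - apply: psd_kraus; last exact: psd_proj.
    by case=> [_|_] /=; rewrite ?divr_ge0 ?invr_ge0 ?mulr_ge0 // ltW.
  - by case=> [_|_] /=; rewrite ?divr_ge0 // invr_ge0 ltW.
  - case=> [_|p] /=; last by rewrite !ip_tensrow ip_delta eqxx !ip_bvec !mul1r.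
    rewrite /ip trmx_mul map_mxM /= mulmxA -[_ *m _ *m (_ *t _) ^t*]mulmxA.
    rewrite tens_conjtr tensmx_mul tensr_mulct ip_bvec emb_mulct scale1r.
    by rewrite trmx1 map_mx1 mulmx1 tens1mx1 mulmx1; exact: ip_max_entangled.
  rewrite /kraus !big_sumType /= !(big_pred1 tt) => [|[]|[]] //=; congr (_ + _).
    by rewrite conj_proj.
  apply: eq_bigr => -[k l] _ /=; rewrite tensr_ketbra kraus_ketbra_tens.
  rewrite [in RHS]proj_tensrow.
  (* Outcome [k] on one half has probability [1 / n] and leaves the other half in [|k>]; this turns
     the weight [(3 * n)^-1] into [(3 * (n * n))^-1]. *)
  have -> : ptblock (proj max_entangled) k = (n%:R^-1)%:C *: proj (delta_mx 0 k).
    apply/matrixP => p q; rewrite mxE proj_max_entangledE [RHS]mxE projE !mxE !eqxx /= conjC_nat.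
    by rewrite mulrA.
  apply/matrixP => p q; rewrite !mxE !invfM !rmorphM /=; ring.
rewrite big_sumType /= (big_pred1 tt) => [|[]] //=.
rewrite sumr_const card_prod card_ord entf_inv // !lnM ?posrE ?mulr_gt0 //.
(* The tangent at 1 gives [1 - 2 / 3]. With [ln 3 <= 2] the constants add up to
   [1 / 3 + 2 / 3 = 1]. *)
have h1 : entf (2 / 3 : R) <= 3^-1.
  have := @entf_le R 1 (2 / 3) ltr01; rewrite ln1 mulr0 invr1 => h.
  apply: le_trans (h _) _; lra.
have h3 : ln 3 <= 2 :> R by apply: le_trans (ln_le_subr1 _) _ => //; lra.
rewrite -[(_ * _) *+ _]mulr_natl natrM.
have -> : n%:R * n%:R * ((3 * (n%:R * n%:R))^-1 * (ln 3 + (ln n%:R + ln n%:R))) =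
  3^-1 * (ln 3 + 2 * ln n%:R) :> R by field.
lra.
Qed.

(** Uniform letters [i] with maximally entangled inputs achieve
    [2 * ln n + (ln n - 2 / 3 * ln n - 1)]. *)
Lemma Cprod_tens_ge :
  ((7 / 3 * ln n%:R - 1)%:E <= Cprod n (tensmap (@chan R n) (@chan R n)))%E.
Proof.
apply: (@le_trans _ _ (Cprod_value (tensmap (@chan R n) (@chan R n))
  (fun _ : 'I_n => n%:R^-1) encode (fun=> proj max_entangled))%:E); last first.
  apply: ereal_sup_ubound; exists n, (fun=> n%:R^-1), encode, (fun=> proj max_entangled); split => //.
  - split; first by move=> _; rewrite invr_ge0 ltW.
    by rewrite sumr_const card_ord -[_^-1 *+ _]mulr_natl mulfV.
  - exact: encode_channel.
  - by move=> _; exact: max_entangled_pure.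
rewrite lee_fin /Cprod_value entropy_output ptrace2_max_entangled entropy_mixed.
apply: le_trans (_ : 2 * ln n%:R + \sum_(i < n) n%:R^-1 *
  (ln n%:R - (2 / 3 * ln n%:R + 1)) <= _).
  by rewrite sumr_const card_ord -[(_ * _) *+ n]mulr_natl mulrA mulfV // mul1r; lra.
rewrite lerD2l; apply: ler_sum => i _; apply: ler_wpM2l; first by rewrite invr_ge0 ltW.
by rewrite lerD2l lerN2 entropy_joint_le.
Qed.

End Lower.

End LowerBound.

Theorem theorem1p2 (R : realType) :
  exists K : R, 0 <= K /\
    forall n r : nat, (0 < n)%N -> n = (r ^ 2)%N ->
      exists N : 'M[R[i]]_(2 * n) -> 'M[R[i]]_(2 * n),
        is_channel N /\
        ((3^-1 * ln n%:R)%:E + 2%:E * Cprod r N - K%:E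
           <= Cprod n (tensmap N N))%E.
Proof.
have l2 : 0 <= ln 2 :> R by rewrite ln_ge0 // ler1n.
(* Twice the one-copy constant [3 * ln 2 + 1], plus the 1 lost in [Cprod_tens_ge]. *)
exists (6 * ln 2 + 3); split; first lra.
move=> n r n0 nr; exists (@chan R n); split; first exact: chan_channel.
apply: le_trans (Cprod_tens_ge R n0).
have up : (Cprod r (@chan R n) <= (ln n%:R + 3 * ln 2 + 1)%:E)%E.
  apply: ge_ereal_sup => _ [N [lam [phi [eta [[lam0 lam1] hphi heta ->]]]]].
  by rewrite lee_fin; exact: Cprod_value_le.
apply: (@le_trans _ _ ((3^-1 * ln n%:R)%:E + 2%:E * (ln n%:R + 3 * ln 2 + 1)%:E
  - (6 * ln 2 + 3)%:E)%E).
  by rewrite leeB // leeD2l // lee_wpmul2l // lee_fin.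
by rewrite -EFinM -EFinD lee_fin; lra.
Qed.
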